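(* Let $n\ge2$ and let $N$ be a symplectic matroid of rank $2$ over $E_n=[n]\cup[n^*]$. Then $N$ is representable over $\mathbb C$ if and only if there exists an $S_{2n}$-matroid $M$ (ordinary matroid of rank $2$ on $E_n$) of degree $d\neq1$ such that $\pi(M)=N$.
   Context: Let $E_n=[n]\cup[n^*]$, identified with $[2n]$ via $i^*=2n+1-i$, $i^{**}=i$. A subset $S\subset E_n$ is admissible if $S\cap S^*=\emptyset$, where $S^*=\{i^*:i\in S\}$; $J_n^2$ is the set of admissible $2$-subsets of $E_n$, i.e. $\{i,j\}$ with $j\ne i^*$. A total order $<$ on $E_n$ is admissible if, listing the $2n$ elements from largest to smallest, the first $n$ elements form an admissible set and the last $n$ elements are the stars of the first $n$ listed in reverse order. An admissible order induces a partial order on $J_n^2$: for $\{i<j\},\{k<l\}\in J_n^2$, $\{i<j\}\le\{k<l\}$ iff $i\le k$ and $j\le l$. A symplectic matroid of rank $2$ on $E_n$ ($BC_n$-matroid of rank $2$) is a triple $N=(E_n,*,B)$ with $\emptyset\neq B\subset J_n^2$ such that $B$ has a unique maximal element with respect to the partial order induced by every admissible order on $E_n$. With $\mathrm{SpG}(2,2n)$ the set of $2$-planes in $\mathbb C^{2n}$ with Plücker coordinates $[x_{i,j}]$ satisfying $\sum_{i=1}^n x_{i,i^*}=0$ (isotropic $2$-planes for a symplectic form), $N=(E_n,*,B)$ is representable over $\mathbb C$ if there is $x\in\mathrm{SpG}(2,2n)$ with $B=\{\{i,j\}\in J_n^2:x_{i,j}\ne0\}$. For an ordinary rank $2$ matroid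 $M$ on $E_n$ with set of bases $B(M)$: $A(M)=\{i\in[n]:\{i,i^*\}\in B(M)\}$, the degree is $\deg(M)=\#A(M)$, and the symplectic projection is $\pi(M)=(E_n,*,B(M)\setminus\{\{i,i^*\}:i\in A(M)\})$. *)

(* Defs.v *)
From HB Require Import structures.
From mathcomp Require Import all_boot all_order all_algebra.
From mathcomp Require Import complex.
From mathcomp Require Import reals.

Set Implicit Arguments.
Unset Strict Implicit.
Unset Printing Implicit Defensive.

Import GRing.Theory.
Local Open Scope ring_scope.

(* E_n = [n] u [n^*] is identified with [2n], indexed from 0: the element      *)
(* k of [2n] is the ordinal k - 1, so [n] is {i | i < n}, and k^* = 2n + 1 - k *)
(* becomes i |-> 2n - 1 - i, which is rev_ord.                                 *)
Notation ground n := 'I_(2 * n).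

Definition star (n : nat) (i : ground n) : ground n := rev_ord i.

Definition admissible (n : nat) (S : {set ground n}) : bool :=
  S :&: @star n @: S == set0.

Definition J2 (n : nat) : {set {set ground n}} :=
  [set S : {set ground n} | (#|S| == 2)%N && admissible S].

Definition total_order (T : Type) (le : rel T) : Prop :=
  [/\ reflexive le, antisymmetric le, transitive le & total le].

Definition decreasing_listing (n : nat) (le : rel (ground n)) :
    seq (ground n) :=
  sort (fun x y => le y x) (enum (ground n)).

Definition admissible_order (n : nat) (le : rel (ground n)) : Prop :=
  let s := decreasing_listing le in
  [/\ total_order le,
      admissible [set x in take n s]
    & drop n s = rev (map (@star n) (take n s))].

Definition induced_le (n : nat) (le : rel (ground n))
    (S T : {set ground n}) : Prop :=
  exists i j k l : ground n,
    [/\ S = [set i; j], i != j & le i j] /\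
    [/\ T = [set k; l], k != l & le k l] /\
    (le i k /\ le j l).

Definition maximal_in (n : nat) (le : rel (ground n))
    (B : {set {set ground n}}) (S : {set ground n}) : Prop :=
  S \in B /\ (forall T, T \in B -> induced_le le S T -> T = S).

(* E_n and * being determined by n, (symplectic) matroids are represented by   *)
(* their collections of bases.                                                 *)
Definition symplectic_matroid2 (n : nat) (B : {set {set ground n}}) : Prop :=
  [/\ B != set0, B \subset J2 n
    & forall le : rel (ground n), admissible_order le ->
        exists! S, maximal_in le B S].

Definition matroid2 (n : nat) (B : {set {set ground n}}) : Prop :=
  [/\ B != set0,
      forall S, S \in B -> #|S| = 2%N
    & forall S T, S \in B -> T \in B -> forall x, x \in S :\: T ->
        exists2 y, y \in T :\: S & y |: (S :\ x) \in B].

(* The Pluecker coordinate for the library's chosen basis of V; another basis  *)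
(* multiplies all the coordinates of a plane by a common nonzero scalar.       *)
Definition plucker (K : fieldType) (n : nat) (V : {vspace 'rV[K]_(2 * n)})
    (i j : ground n) : K :=
  \det (\matrix_(a < 2, b < 2) (vbasis V)`_a 0 (tnth [tuple i; j] b)).

Definition SpG2 (K : fieldType) (n : nat) (V : {vspace 'rV[K]_(2 * n)}) : Prop :=
  (\dim V = 2)%N /\
  \sum_(i : ground n | (i < n)%N) plucker V i (star i) = 0.

Definition representable (K : fieldType) (n : nat)
    (B : {set {set ground n}}) : Prop :=
  exists V : {vspace 'rV[K]_(2 * n)}, SpG2 V /\
    B = [set S in J2 n |
          [exists i, exists j, (S == [set i; j]) && (plucker V i j != 0)]].

Definition pairing_set (n : nat) (B : {set {set ground n}}) : {set ground n} :=
  [set i : ground n | (i < n)%N && ([set i; star i] \in B)].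

Definition degree (n : nat) (B : {set {set ground n}}) : nat :=
  #|pairing_set B|.

Definition symplectic_projection (n : nat) (B : {set {set ground n}}) :
    {set {set ground n}} :=
  B :\: [set [set i; star i] | i in pairing_set B].

(* Main.v *)
Require Import Defs.
From HB Require Import structures.
From mathcomp Require Import all_boot all_order all_algebra.
From mathcomp Require Import complex.
From mathcomp Require Import reals.
From mathcomp Require Import ring zify.

(** A plane with basis [u], [v] has Pluecker coordinates
    [minor2 u v i j = u_i v_j - u_j v_i], so the pairs on which they do not
    vanish are the bases of an ordinary rank 2 matroid [M]; the three-term
    Pluecker relation is exactly what the exchange axiom needs
    ([minor2_matroid]).  The plane is isotropic when the coordinates
    [x_{i,i^*}] sum to zero, and a vanishing sum cannot have exactly one
    nonzero term, so [M] has degree different from 1.  Deleting the pairs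
    [{i,i^*}] from [M] leaves the symplectic matroid of the plane.

    Conversely, in a rank 2 matroid [M] the relation [{i,j} \notin M] is an
    equivalence on nonloops ([parallel_trans]).  Giving each parallel class its
    own slope [a], the columns [t_i (1, a_i)], with [t_i = 0] exactly on the
    loops, represent [M] whatever the nonzero scalars [t_i] are, and
    [x_{i,i^*} = t_i t_{i^*} (a_{i^*} - a_i)].  Each coordinate [x_{i,i^*}] with
    [{i,i^*} \in M] and [i] in the first half can thus be prescribed
    independently to be any nonzero scalar, by adjusting [t_i] alone
    ([realize_pairing]).  If [M] has degree [d], it remains to find [d] nonzero
    scalars of sum zero, which is possible as soon as [d != 1]: take [1] except
    for one entry [-(d - 1)] ([nonzero_sum0]). *)

Set Implicit Arguments.
Unset Strict Implicit.
Unset Printing Implicit Defensive.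

Import GRing.Theory Num.Theory.
Local Open Scope ring_scope.

(** * Pairs and the star involution *)

Lemma starK n : involutive (@star n).
Proof. exact: rev_ordK. Qed.

Lemma ltn_star n (i : ground n) : (star i < n)%N = (n <= i)%N.
Proof.
by rewrite /star /=; have := ltn_ord i; lia.
Qed.

Lemma star_neq n (i : ground n) : star i != i.
Proof.
by apply/eqP=> e; have := ltn_star i; rewrite e ltnNge; case: (n <= i)%N.
Qed.

Lemma set2_eqP (T : finType) (a b c d : T) : [set a; b] = [set c; d] ->
  (a = c /\ b = d) \/ (a = d /\ b = c).
Proof.
move=> e.
have /set2P ha : a \in [set c; d] by rewrite -e set21.
have /set2P hb : b \in [set c; d] by rewrite -e set22.
have /set2P hc : c \in [set a; b] by rewrite e set21.
have /set2P hd : d \in [set a; b] by rewrite e set22.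
by case: ha hb hc hd => -> [] -> [] ? [] ?; subst; auto.
Qed.

Lemma admissible_pair n (i j : ground n) :
  admissible [set i; j] = (j != star i).
Proof.
rewrite /admissible imsetU1 imset_set1; apply/eqP/idP => [e|/eqP ji].
  apply/eqP=> ji; have := in_set0 j; rewrite -e !inE eqxx orbT /=.
  by rewrite -ji eqxx.
apply/setP=> x; rewrite !inE; apply/negP=> /andP[/orP[]/eqP-> /orP[]/eqP e].
- by have := star_neq i; rewrite -e eqxx.
- by apply: ji; rewrite e starK.
- by apply: ji.
- by have := star_neq j; rewrite -e eqxx.
Qed.

Lemma pair_in_J2 n (i j : ground n) :
  ([set i; j] \in J2 n) = (i != j) && (j != star i).
Proof. by rewrite inE admissible_pair cards2; case: (i != j). Qed.

(** The symplectic projection keeps exactly the admissible bases. *)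
Lemma symplectic_projectionE n (M : {set {set ground n}}) :
  (forall S, S \in M -> #|S| = 2%N) ->
  symplectic_projection M = [set S in M | S \in J2 n].
Proof.
move=> cardM; apply/setP=> S; rewrite in_setD [RHS]inE andbC.
case SM: (S \in M) => //=.
have /eqP/cards2P[i [j [ij eS]]] := cardM S SM; subst S.
rewrite pair_in_J2 ij /=; congr negb; apply/imsetP/eqP => [[k _ e]|e].
  by case: (set2_eqP e) => -[-> ->] //; rewrite starK.
have [lt_in|le_ni] := ltnP i n.
  by exists i; rewrite ?inE -e // lt_in SM.
have si : star j = i by rewrite e starK.
exists j; rewrite ?inE ?si setUC //.
by rewrite SM andbT e ltn_star.
Qed.

(** * Pluecker coordinates *)

(** The 2 x 2 minor on columns [i], [j] of the matrix with rows [u], [v]. *)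
Definition minor2 (K : fieldType) m (u v : 'rV[K]_m) (i j : 'I_m) : K :=
  u 0 i * v 0 j - u 0 j * v 0 i.

Lemma pluckerE (K : fieldType) n (V : {vspace 'rV[K]_(2 * n)}) i j :
  plucker V i j = minor2 (vbasis V)`_0 (vbasis V)`_1 i j.
Proof.
rewrite /plucker (expand_det_row _ ord0) !big_ord_recl big_ord0 /cofactor.
rewrite !det_mx11 !mxE !(tnth_nth i) /= /minor2; ring.
Qed.

Section Minors.
Variables (K : fieldType) (m : nat) (u v : 'rV[K]_m).

Lemma minor2C i j : minor2 u v j i = - minor2 u v i j.
Proof. by rewrite /minor2; ring. Qed.

Lemma minor2_diag i : minor2 u v i i = 0.
Proof. by rewrite /minor2; ring. Qed.

Lemma minor2_plucker_rel i j k l :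
  minor2 u v i j * minor2 u v k l =
    minor2 u v i k * minor2 u v j l - minor2 u v i l * minor2 u v j k.
Proof. by rewrite /minor2; ring. Qed.

(** The pairs of columns that are linearly independent. *)
Definition minor2_bases : {set {set 'I_m}} :=
  [set S | [exists i, exists j, (S == [set i; j]) && (minor2 u v i j != 0)]].

Lemma minor2_basesP S :
  reflect (exists i j, S = [set i; j] /\ minor2 u v i j != 0)
          (S \in minor2_bases).
Proof.
rewrite inE; apply: (iffP existsP) => [[i /existsP[j /andP[/eqP ? ?]]]|].
  by exists i, j.
by case=> i [j [-> ?]]; exists i; apply/existsP; exists j; rewrite eqxx.
Qed.

Lemma pair_in_minor2_bases i j :
  ([set i; j] \in minor2_bases) = (minor2 u v i j != 0).
Proof.
apply/minor2_basesP/idP => [[k [l []]]|ij]; last by exists i, j.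
by case/set2_eqP=> -[-> ->] //; rewrite minor2C oppr_eq0.
Qed.

Lemma card_minor2_basis S : S \in minor2_bases -> #|S| = 2%N.
Proof.
case/minor2_basesP=> i [j [-> nz]]; rewrite cards2.
by case: (eqVneq i j) nz => [->|//]; rewrite minor2_diag eqxx.
Qed.

End Minors.

(** The columns of a matrix with two rows form a matroid: exchange is the
    three-term Pluecker relation. *)
Lemma minor2_matroid (K : fieldType) n (u v : 'rV[K]_(2 * n)) :
  minor2_bases u v != set0 -> matroid2 (minor2_bases u v).
Proof.
move=> M0; split=> //; first exact: card_minor2_basis.
move=> S T SM TM x /setDP[xS xT].
have [j [eS nz]] : exists j, S = [set x; j] /\ minor2 u v x j != 0.
  case/minor2_basesP: SM xS => a [b [-> nz]] /set2P[]->; first by exists b.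
  by exists a; rewrite setUC minor2C oppr_eq0.
have xj : x != j by apply: contraNneq nz => ->; rewrite minor2_diag.
case/minor2_basesP: TM xT => k [l [-> nzT]] xT.
have [y yT nzy] : exists2 y, y \in [set k; l] & minor2 u v y j != 0.
  have [k0|] := eqVneq (minor2 u v k j) 0; last by exists k; rewrite ?set21.
  exists l; rewrite ?set22 //; apply: contraNneq nz => l0.
  (* Both products on the right of the Pluecker relation for (x j | k l)
     contain a minor on column j. *)
  have /eqP := minor2_plucker_rel u v x j k l.
  rewrite (minor2C _ _ l j) (minor2C _ _ k j) l0 k0 oppr0 !mulr0 subr0.
  by rewrite mulf_eq0 (negPf nzT) orbF.
have yj : y != j by apply: contraNneq nzy => ->; rewrite minor2_diag.
have yx : y != x by apply: contraNneq xT => <-.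
exists y; first by rewrite eS in_setD yT !inE negb_or yx yj.
suff -> : y |: S :\ x = [set y; j] by rewrite pair_in_minor2_bases.
rewrite eS setU1K // inE; exact: xj.
Qed.

Lemma plucker_bases (K : fieldType) n (V : {vspace 'rV[K]_(2 * n)}) :
  [set S in J2 n |
    [exists i, exists j, (S == [set i; j]) && (plucker V i j != 0)]]
  = [set S in minor2_bases (vbasis V)`_0 (vbasis V)`_1 | S \in J2 n].
Proof.
apply/setP=> S; rewrite !inE andbC; congr (_ && _).
by apply: eq_existsb => i; apply: eq_existsb => j; rewrite pluckerE.
Qed.

(** Two rows with a nonzero minor span a plane, and its Pluecker coordinates
    are proportional to the minors. *)
Lemma span_plucker (K : fieldType) n (u v : 'rV[K]_(2 * n)) i0 j0 :
    minor2 u v i0 j0 != 0 ->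
  \dim <<[:: u; v]>> = 2%N /\
  exists2 c : K, c != 0
    & forall i j, minor2 u v i j = c * plucker <<[:: u; v]>> i j.
Proof.
move=> nz; set V := (<<_>>)%VS.
have dimV : \dim V = 2%N.
  suff : free [:: u; v] by move/eqP.
  rewrite free_cons seq1_free span_seq1; apply/andP; split; last first.
    by apply: contraNneq nz => ->; rewrite /minor2 !mxE !mulr0 subr0.
  apply: contraNN nz => /vlineP[k ->].
  by rewrite /minor2 !mxE; apply/eqP; ring.
split=> //.
have decomp w : w \in V ->
    exists a b : K, w = a *: (vbasis V)`_0 + b *: (vbasis V)`_1.
  move=> /coord_vbasis->; move: (vbasis V) => X.
  rewrite dimV in X *.
  rewrite big_ord_recl big_ord1.
  by eexists; eexists.
have [|a [b eu]] := decomp u; first by apply: memv_span; rewrite !inE eqxx.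
have [|c [d ev]] := decomp v.
  by apply: memv_span; rewrite !inE eqxx orbT.
have E i j : minor2 u v i j = (a * d - b * c) * plucker V i j.
  by rewrite pluckerE {1}/minor2 eu ev /minor2 !mxE; ring.
exists (a * d - b * c) => //.
by apply: contraNneq nz => c0; rewrite E c0 mul0r.
Qed.

(** * Parallel classes of a rank 2 matroid *)

Section Matroid.
Variables (n : nat) (M : {set {set ground n}}).
Hypothesis matM : matroid2 M.

(** An element of some basis. *)
Definition nonloop (i : ground n) : bool := i \in cover M.

(** The elements parallel to [i], loops included. *)
Definition parallel_class (i : ground n) : {set ground n} :=
  [set j | [set i; j] \notin M].

Lemma basis_nonloop i j : [set i; j] \in M -> nonloop i && nonloop j.
Proof.
move=> ij; rewrite /nonloop.
by apply/andP; split; apply/bigcupP; exists [set i; j]; rewrite ?set21 ?set22.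
Qed.

Lemma basis_neq i j : [set i; j] \in M -> i != j.
Proof.
by case: matM => _ cardM _ /cardM; rewrite cards2; case: (i != j).
Qed.

Lemma nonloopP i : nonloop i -> exists j, [set i; j] \in M.
Proof.
case: matM => _ cardM _ /bigcupP[S SM].
have /eqP/cards2P[a [b [_ eS]]] := cardM S SM.
by rewrite eS in SM * => /set2P[]->; [exists b | exists a; rewrite setUC].
Qed.

Lemma parallel_trans j i k : nonloop j ->
  [set i; j] \notin M -> [set j; k] \notin M -> [set i; k] \notin M.
Proof.
case/nonloopP=> p jp; rewrite setUC => ji jk; apply/negP=> ik.
have pT : p \notin [set i; k].
  by apply/negP=> /set2P[] e; move: jp; rewrite e ?(negPf ji) ?(negPf jk).
have jNp := basis_neq jp.
(* Exchanging p in the basis {j, p} keeps j. *)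
have [|y /setDP[yT _]] := let: And3 _ _ ex := matM in ex _ _ jp ik p.
  by rewrite in_setD pT set22.
have -> : y |: [set j; p] :\ p = [set j; y].
  by rewrite [[set j; p]]setUC setU1K 1?setUC // inE eq_sym.
by case/set2P: yT => ->; apply/negP.
Qed.

Lemma eq_parallel_class i j : nonloop i -> nonloop j ->
  (parallel_class i == parallel_class j) = ([set i; j] \notin M).
Proof.
move=> nli nlj; apply/eqP/idP => [e|ij].
  have : j \in parallel_class j.
    by rewrite inE; apply/negP=> /basis_neq; rewrite eqxx.
  by rewrite -e inE.
apply/setP=> k; rewrite !inE; apply/idP/idP; apply: parallel_trans => //.
by rewrite setUC.
Qed.

Lemma pairing_starN i : i \in pairing_set M -> star i \notin pairing_set M.
Proof. by rewrite !inE ltn_star => /andP[lt_in _]; rewrite leqNgt lt_in. Qed.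

(** * Realization with prescribed pairing coordinates *)

Variable K : numFieldType.

(** The slope of the column [i]: a scalar numbering its parallel class. *)
Definition slope (i : ground n) : K := (enum_rank (parallel_class i))%:R.

Lemma eq_slope i j : nonloop i -> nonloop j ->
  (slope i == slope j) = ([set i; j] \notin M).
Proof.
move=> nli nlj; rewrite -eq_parallel_class // /slope eqr_nat.
by rewrite (inj_eq val_inj) (inj_eq enum_rank_inj).
Qed.

(** Nonzero scalars can be prescribed as the coordinates [x_{i,i^*}] for the
    [i] that [M] pairs with [i^*]. *)
Lemma realize_pairing (s : ground n -> K) : (forall i, s i != 0) ->
  exists u v : 'rV[K]_(2 * n),
    minor2_bases u v = M /\
    forall i, i \in pairing_set M -> minor2 u v i (star i) = s i.
Proof.
move=> s_neq0.
pose t i : K :=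
  if ~~ nonloop i then 0
  else if i \in pairing_set M then s i / (slope (star i) - slope i) else 1.
pose u : 'rV[K]_(2 * n) := \row_i t i.
pose v : 'rV[K]_(2 * n) := \row_i (t i * slope i).
have slopeN i : i \in pairing_set M -> slope (star i) - slope i != 0.
  rewrite inE => /andP[_ iM]; have /andP[nli nlsi] := basis_nonloop iM.
  by rewrite subr_eq0 eq_sym eq_slope // negbK.
have t_eq0 i : (t i == 0) = ~~ nonloop i.
  rewrite /t; case: ifP => [|_]; first by rewrite eqxx.
  case: ifP => [iA|_]; last exact: oner_eq0.
  by rewrite mulf_eq0 invr_eq0 (negPf (s_neq0 i)) (negPf (slopeN i iA)).
have uvE i j : minor2 u v i j = t i * t j * (slope j - slope i).
  by rewrite /minor2 !mxE; ring.
have pairE i j : ([set i; j] \in minor2_bases u v) = ([set i; j] \in M).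
  rewrite pair_in_minor2_bases uvE !mulf_eq0 !t_eq0 subr_eq0 eq_sym.
  have [nli|lpi] /= := boolP (nonloop i); last first.
    by apply/esym/negbTE; apply: contraNN lpi => /basis_nonloop/andP[].
  have [nlj|lpj] /= := boolP (nonloop j); last first.
    by apply/esym/negbTE; apply: contraNN lpj => /basis_nonloop/andP[].
  by rewrite eq_slope // negbK.
exists u, v; split.
  have [_ cardM _] := matM.
  apply/setP=> S; apply/idP/idP => SM.
    have [i [j [eS _]]] := minor2_basesP _ _ _ SM.
    by rewrite eS -pairE -eS.
  have /eqP/cards2P[i [j [_ eS]]] := cardM S SM.
  by rewrite eS pairE -eS.
move=> i iA; have := iA; rewrite inE => /andP[_ /basis_nonloop/andP[nli nlsi]].
(* The star of i is at least n, so its own scalar is 1. *)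
rewrite uvE /t nli nlsi /= iA (negPf (pairing_starN iA)) mulr1.
by rewrite divfK // slopeN.
Qed.

End Matroid.

Lemma nonzero_sum0 (K : numFieldType) (T : finType) (A : {set T}) :
  #|A| <> 1%N ->
  exists s : T -> K, (forall i, s i != 0) /\ \sum_(i in A) s i = 0.
Proof.
have [->|[i0 i0A]] := set_0Vmem A.
  by exists (fun=> 1); split=> [i|]; rewrite ?oner_eq0 // big_set0.
rewrite (cardsD1 i0) i0A => cA.
exists (fun i => if i == i0 then - #|A :\ i0|%:R else 1); split=> [i|].
  case: ifP => _; last by rewrite oner_eq0.
  by rewrite oppr_eq0 pnatr_eq0; apply/eqP=> c0; apply: cA; rewrite c0.
rewrite (big_setD1 i0) //= eqxx (eq_bigr (fun=> 1)) => [|i].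
  by rewrite sumr_const addNr.
by rewrite !inE => /andP[/negPf->].
Qed.

(** * Isotropic planes *)

(** Terms outside the pairing set vanish. *)
Lemma pairing_sumE (K : fieldType) n (u v : 'rV[K]_(2 * n)) :
  \sum_(i : ground n | (i < n)%N) minor2 u v i (star i) =
  \sum_(i in pairing_set (minor2_bases u v)) minor2 u v i (star i).
Proof.
rewrite [LHS](bigID (mem (pairing_set (minor2_bases u v)))) /=.
rewrite [X in _ + X]big1 ?addr0 => [|i].
  by apply: eq_bigl => i; rewrite inE andbA andbb.
by rewrite inE pair_in_minor2_bases => /andP[->]; rewrite negbK => /eqP.
Qed.

Lemma isotropic_degree (K : fieldType) n (u v : 'rV[K]_(2 * n)) :
  \sum_(i : ground n | (i < n)%N) minor2 u v i (star i) = 0 ->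
  degree (minor2_bases u v) <> 1%N.
Proof.
rewrite pairing_sumE /degree => sum0 /eqP/cards1P[i eA].
have : i \in pairing_set (minor2_bases u v) by rewrite eA set11.
rewrite inE pair_in_minor2_bases => /andP[_ /eqP]; apply.
by move: sum0; rewrite eA big_set1.
Qed.

Lemma representable_projection (K : fieldType) n (N : {set {set ground n}}) :
  N != set0 -> representable K N ->
  exists M, [/\ matroid2 M, degree M <> 1%N & symplectic_projection M = N].
Proof.
move=> N0 [V [[_ sum0] eN]]; rewrite plucker_bases in eN.
exists (minor2_bases (vbasis V)`_0 (vbasis V)`_1); split.
- apply: minor2_matroid; apply: contraNneq N0 => M0.
  by rewrite eN M0; apply/eqP/setP=> S; rewrite !inE.
- apply: isotropic_degree; rewrite -[RHS]sum0.
  by apply: eq_bigr => i _; rewrite pluckerE.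
- by rewrite eN symplectic_projectionE //; apply: card_minor2_basis.
Qed.

Lemma projection_representable (K : numFieldType) n (M : {set {set ground n}}) :
  matroid2 M -> degree M <> 1%N -> representable K (symplectic_projection M).
Proof.
move=> matM degM; have [s [s_neq0 sum0]] := nonzero_sum0 K degM.
have [u [v [eM pairM]]] := realize_pairing matM s_neq0.
have [M0 cardM _] := matM.
have [S SM] := set0Pn _ M0; rewrite -eM in SM.
have [i0 [j0 [_ nz]]] := minor2_basesP _ _ _ SM.
have [dimV [c c_neq0 uvE]] := span_plucker nz.
exists <<[:: u; v]>>%VS; split.
  split=> //; apply: (mulfI c_neq0); rewrite mulr0 mulr_sumr -[RHS]sum0 -eM.
  rewrite (eq_bigr (fun i => minor2 u v i (star i))) => [|i _]; last first.
    by rewrite uvE.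
  by rewrite pairing_sumE; apply: eq_bigr => i; rewrite eM => /pairM.
rewrite symplectic_projectionE // -eM; apply/setP=> T; rewrite !inE andbC.
congr (_ && _); apply: eq_existsb => i; apply: eq_existsb => j.
by rewrite uvE mulf_eq0 (negPf c_neq0).
Qed.

Theorem theorem4p9 (R : realType) (n : nat) (hn : (2 <= n)%N)
    (N : {set {set ground n}}) (hN : symplectic_matroid2 N) :
  representable R[i]%C N <->
  exists M : {set {set ground n}},
    [/\ matroid2 M, degree M <> 1%N & symplectic_projection M = N].
Proof.
case: hN => N0 _ _; split; first exact: representable_projection.
by case=> M [matM degM <-]; apply: projection_representable.
Qed.
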